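(* Let $G$ be a linear oriented hypergraph with incidence dual $G^*$. Then the intersection graph of $G$ equals the strict $2$-section of its dual: $\Lambda(G)=\llbracket G^*\rrbracket_2$.
   Context: A hypergraph $H=(V,E,\mathcal I)$ consists of a finite set $V$ of vertices, a finite family $E=(e_\iota)_{\iota\in\Omega}$ of subsets of $V$ (the edges; an edge may be empty, and edges with different indices are regarded as different even if they coincide as sets) and its incidences $\mathcal I$. All hypergraphs are simple: each vertex $v\in e$ is incident with $e$ exactly once, so $\mathcal I=\{(v,e): v\in e\}$. $H$ is linear if $|e\cap f|\le 1$ for any two edges $e,f$ with distinct indices. An oriented hypergraph is a pair $G=(H,\sigma)$ with $\sigma:\mathcal I\to\{+1,-1\}$; hypergraph terminology for $G$ refers to $H$. The incidence dual $G^*$ has vertex set $E$ and edge family $V$, where $e$ is incident with $v$ in $G^*$ iff $v$ is incident with $e$ in $G$; its orientation is $\sigma^*(e,v)=\sigma(v,e)$. The dual of a linear oriented hypergraph is again linear. Intersection graph: for a linear $G$, $\Lambda(G)$ is the oriented hypergraph with vertex set $E(G)$ and one edge $ef=\{e,f\}$ for each pair of distinct $e,f\in E(G)$ with $e\cap f\ne\varnothing$; if $v\in e\cap f$ then $\sigma_{\Lambda(G)}(e,ef)=\sigma_G(v,e)$ and $\sigma_{\Lambda(G)}(f,ef)=\sigma_G(v,f)$. Strict $2$-section: for a linear $G$, $\llbracket G\rrbracket_2$ is the oriented hypergraph with vertex set $V(G)$ and one edge $f$ for each $2$-element set $f\subseteq V(G)$ contained in some (necessarily unique) edge $e$ of $G$;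 its orientation is $\sigma_{\llbracket G\rrbracket_2}(v,f)=\sigma_G(v,e)$ for $v\in f$. Equality of oriented hypergraphs means: same vertex set, and edge families that agree up to a bijective renaming of edges preserving the vertex sets of the edges and the orientation of each incidence. *)

(* Defs.v *)
From mathcomp Require Import all_boot ssralg ssrint.
Set Implicit Arguments.
Unset Strict Implicit.
Unset Printing Implicit Defensive.

(* The edge family is indexed by a finite type, so edges with distinct indices
   are distinct even if they coincide as sets. *)
Record hypergraph (V : finType) := Hypergraph {
  edge_index : finType;
  edge : edge_index -> {set V}
}.

Definition linear_hypergraph (V : finType) (H : hypergraph V) : Prop :=
  forall e f : edge_index H, e != f -> #|edge e :&: edge f| <= 1.

Definition sign := {s : int | s \in [:: 1%R; (-1)%R]}.

(* The orientation is defined on incidences only: the third argument of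
   [orient], a boolean membership, is proof-irrelevant. *)
Record oriented_hypergraph (V : finType) := OrientedHypergraph {
  underlying :> hypergraph V;
  orient : forall (v : V) (e : edge_index underlying), v \in edge e -> sign
}.

(* The vertex type is a parameter, so only hypergraphs with the same vertex set
   can be compared. *)
Definition oh_eq (V : finType) (G H : oriented_hypergraph V) : Prop :=
  exists phi : edge_index G -> edge_index H,
    [/\ bijective phi,
        forall e, edge (phi e) = edge e
      & forall v e (ve : v \in edge e) (vphie : v \in edge (phi e)),
          orient vphie = orient ve].

Section Dual.
Variables (V : finType) (G : oriented_hypergraph V).

Definition dual_hypergraph : hypergraph (edge_index G) :=
  Hypergraph (fun v : V => [set e : edge_index G | v \in edge e]).

Lemma dual_incidence (e : edge_index G) (v : edge_index dual_hypergraph) :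
  e \in edge v -> (v : V) \in edge e.
Proof. by rewrite inE. Qed.

Definition dual : oriented_hypergraph (edge_index G) :=
  OrientedHypergraph (underlying := dual_hypergraph)
    (fun e v ev => orient (dual_incidence ev)).

End Dual.

Lemma dual_linear (V : finType) (G : oriented_hypergraph V) :
  linear_hypergraph G -> linear_hypergraph (dual G).
Proof.
move=> linG v w neq_vw; apply/card_le1P => e; rewrite !inE => /andP[ve we] f.
rewrite !inE; apply/andP/eqP => [[vf wf]|->] //.
apply/eqP; apply: contraNT neq_vw => neq_fe.
have /card_le1P := linG f e neq_fe.
move=> /(_ v); rewrite inE vf ve => /(_ isT w).
by rewrite !inE wf we eq_sym => /esym.
Qed.

Section IntersectionGraph.
Variables (V : finType) (G : oriented_hypergraph V).

(* One index per unordered pair {e, f}. *)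
Definition meeting_pair (p : {set edge_index G}) : bool :=
  [exists e, exists f,
    [&& e != f, edge e :&: edge f != set0 & p == [set e; f]]].

Definition intersection_hypergraph : hypergraph (edge_index G) :=
  Hypergraph (fun p : {p | meeting_pair p} => val p).

Lemma meeting_vertex_ex (p : edge_index intersection_hypergraph) :
  exists v : V, v \in \bigcap_(g in edge p) edge g.
Proof.
case: p => p /= /existsP[e /existsP[f /and3P[_ /set0Pn[v]]]].
rewrite inE => /andP[ve vf] /eqP ->; exists v; apply/bigcapP => g.
by rewrite !inE => /orP[/eqP ->|/eqP ->].
Qed.

(* A vertex in e :&: f where p = {e, f}; it is unique when G is linear, so the
   choice is immaterial: see [intersection_graph_orientE]. *)
Definition meeting_vertex (p : edge_index intersection_hypergraph) : V :=
  xchoose (meeting_vertex_ex p).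

Lemma meeting_vertexP (p : edge_index intersection_hypergraph)
    (e : edge_index G) :
  e \in edge p -> meeting_vertex p \in edge e.
Proof. by move: e; apply/bigcapP/xchooseP. Qed.

Definition intersection_graph : oriented_hypergraph (edge_index G) :=
  OrientedHypergraph (underlying := intersection_hypergraph)
    (fun e p ep => orient (meeting_vertexP ep)).

Lemma intersection_graph_orientE (linG : linear_hypergraph G)
    (p : edge_index intersection_graph) (e f : edge_index G) (v : V)
    (ep : e \in edge p) (fp : f \in edge p) (neq_ef : e != f)
    (ve : v \in edge e) (vf : v \in edge f) :
  orient ep = orient ve.
Proof.
rewrite /=; move: (meeting_vertexP ep) (meeting_vertexP fp) => we wf.
have eq_wv : meeting_vertex p = v.
  have /card_le1P/(_ v) := linG e f neq_ef.
  rewrite inE ve vf => /(_ isT (meeting_vertex p)).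
  by rewrite !inE we wf => /esym/eqP.
by move: we; rewrite eq_wv => we; rewrite (bool_irrelevance we ve).
Qed.

End IntersectionGraph.

Section StrictTwoSection.
Variables (V : finType) (G : oriented_hypergraph V).

Definition two_section_pair (f : {set V}) : bool :=
  (#|f| == 2) && [exists e : edge_index G, f \subset edge e].

Definition strict_2section_hypergraph : hypergraph V :=
  Hypergraph (fun f : {f | two_section_pair f} => val f).

Lemma containing_edge_ex (f : edge_index strict_2section_hypergraph) :
  exists e : edge_index G, edge f \subset edge e.
Proof. by case: f => f /= /andP[_ /existsP]. Qed.

(* The edge of G containing f; it is unique when G is linear, so the choice is
   immaterial: see [strict_2section_orientE]. *)
Definition containing_edge (f : edge_index strict_2section_hypergraph) :
    edge_index G :=
  xchoose (containing_edge_ex f).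

Lemma containing_edgeP (f : edge_index strict_2section_hypergraph) (v : V) :
  v \in edge f -> v \in edge (containing_edge f).
Proof. by move: v; apply/subsetP/(xchooseP (containing_edge_ex f)). Qed.

Definition strict_2section : oriented_hypergraph V :=
  OrientedHypergraph (underlying := strict_2section_hypergraph)
    (fun v f vf => orient (containing_edgeP vf)).

Lemma strict_2section_orientE (linG : linear_hypergraph G)
    (f : edge_index strict_2section) (e : edge_index G) (v : V)
    (vf : v \in edge f) (sub_fe : edge f \subset edge e) (ve : v \in edge e) :
  orient vf = orient ve.
Proof.
have eq_e : containing_edge f = e.
  apply/eqP; apply: contraT => /linG.
  have /andP[/eqP card_f _] := valP f.
  rewrite leqNgt -[X in X < _]/(1) -card_f subset_leq_card //.
  by rewrite subsetI sub_fe andbT; apply/subsetP => w; apply: containing_edgeP.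
rewrite /=; move: (containing_edgeP vf); rewrite eq_e => ve'.
by rewrite (bool_irrelevance ve' ve).
Qed.

End StrictTwoSection.

(* Main.v *)
Require Import Defs.
From mathcomp Require Import all_boot.
Set Implicit Arguments.
Unset Strict Implicit.
Unset Printing Implicit Defensive.

(** Two edges [e], [f] of [G] share a vertex [v] exactly when the dual edge [v] contains both, so
    the two edge families consist of the same pairs ([meeting_pair_dual]). Both orientations read
    the sign of [e] at a common vertex; since [dual G] is linear, that vertex is unique and the
    signs agree ([strict_2section_orientE]). *)

Lemma meeting_pair_dual (V : finType) (G : oriented_hypergraph V)
    (p : {set edge_index G}) :
  meeting_pair p = two_section_pair (dual G) p.
Proof.
apply/existsP/andP => [[e /existsP[f /and3P[neq_ef /set0Pn[v]]]]|].
  rewrite inE => /andP[ve vf] /eqP ->; rewrite cards2 neq_ef; split=> //.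
  by apply/existsP; exists v; rewrite subUset !sub1set !inE ve vf.
move=> [/cards2P[e [f [neq_ef ->]]] /existsP[v]].
rewrite subUset !sub1set !inE => /andP[ve vf].
exists e; apply/existsP; exists f; rewrite neq_ef eqxx andbT /=.
by apply/set0Pn; exists v; rewrite inE ve vf.
Qed.

Theorem theorem3p1 (V : finType) (G : oriented_hypergraph V)
    (linG : linear_hypergraph G) :
  oh_eq (intersection_graph G) (strict_2section (dual G)).
Proof.
have to_pair (p : {p | meeting_pair p}) : two_section_pair (dual G) (val p).
  by rewrite -meeting_pair_dual; apply: valP.
have of_pair (f : {f | two_section_pair (dual G) f}) : meeting_pair (val f).
  by rewrite meeting_pair_dual; apply: valP.
(* The renaming keeps the underlying pair and changes only its certificate, so vertex sets agree by
   computation. *)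
exists (fun p => exist _ (val p) (to_pair p)); split=> //.
  by exists (fun f => exist _ (val f) (of_pair f)) => p; apply: val_inj.
move=> e p ep ep'.
(* The vertex chosen for [intersection_graph], viewed as a dual edge, contains [p]; it can thus
   replace the choice made in [strict_2section]. *)
have sub_p : edge p \subset edge (meeting_vertex p : edge_index (dual G)).
  by apply/subsetP => f fp; rewrite inE; apply: meeting_vertexP.
rewrite (strict_2section_orientE (dual_linear linG) ep' sub_p
           (subsetP sub_p e ep)) /=.
by congr orient; apply: bool_irrelevance.
Qed.
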